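(* Let $\hat\gamma:\mathbb{R}/2\pi\mathbb{Z}\to(0,\infty)$ be globally $C^1$ and piecewise $C^2$, and suppose that (a) $3\hat\gamma(\theta)\ge\hat\gamma(\theta-\pi)$ for all $\theta\in\mathbb{R}/2\pi\mathbb{Z}$, and (b) $\hat\gamma'(\theta^* )=0$ for every $\theta^*\in\mathbb{R}/2\pi\mathbb{Z}$ with $3\hat\gamma(\theta^* )=\hat\gamma(\theta^*-\pi)$. Then, for sufficiently large $k(\theta)$, the SPFEM for solid-state dewetting (the fully discrete scheme for open curves defined in the context) is area conservative and unconditionally energy dissipative. That is, there is a function $k_*:\mathbb{R}/2\pi\mathbb{Z}\to[0,\infty)$ depending only on $\hat\gamma$ such that, for every stabilizing function $k:\mathbb{R}/2\pi\mathbb{Z}\to[0,\infty)$ with $k(\theta)\ge k_*(\theta)$ for all $\theta$, every $N>2$, every time step $\tau>0$ and every sequence of solutions $(\boldsymbol{X}^{m+1},\mu^{m+1})$, $m=0,1,2,\dots$, of the scheme, $$A_o^{m+1}=A_o^m=\cdots=A_o^0,\qquad W_o^{m+1}\le W_o^m\le\cdots\le W_o^0,\qquad\forall m\ge0.$$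
   Context: Notation. For $\boldsymbol{v}=(v_1,v_2)^T\in\mathbb{R}^2$, $\boldsymbol{v}^\perp=(v_2,-v_1)^T$. ''Piecewise $C^2$'' means the circle splits into finitely many closed arcs on each of which the function is $C^2$ (one-sided derivatives at endpoints). $\sigma\in\mathbb{R}$ (the cosine of the isotropic Young contact angle) and $0<\eta<\infty$ (the contact line mobility) are constants. Surface energy matrix: $$\hat{\boldsymbol{G}}_k(\theta)=\begin{pmatrix}\hat\gamma(\theta)&-\hat\gamma'(\theta)\\ \hat\gamma'(\theta)&\hat\gamma(\theta)\end{pmatrix}+k(\theta)\begin{pmatrix}\sin^2\theta&-\cos\theta\sin\theta\\-\cos\theta\sin\theta&\cos^2\theta\end{pmatrix}.$$ Finite element spaces: $N>2$ an integer, $h=1/N$, $\rho_j=jh$, $I_j=[\rho_{j-1},\rho_j]$, $\mathbb{I}=[0,1]$. $\mathbb{K}^h$ is the space of continuous real functions on $\mathbb{I}$ that are affine on each $I_j$; $\mathbb{K}^h_0=\{u\in\mathbb{K}^h:u(0)=u(1)=0\}$; $\mathbb{X}^h=\mathbb{K}^h\times\mathbb{K}^h_0$. Discrete curves: $\Gamma^m=\boldsymbol{X}^m(\mathbb{I})$ with $\boldsymbol{X}^m=(x^m,y^m)^T\in\mathbb{X}^h$ approximates the open curve at time $m\tau$; $\boldsymbol{h}^m_j=\boldsymbol{X}^m(\rho_j)-\boldsymbol{X}^m(\rho_{j-1})$, always assumed nonzero; $x_l^m=x^m(0)$ and $x_r^m=x^m(1)$. The angle $\theta^m$ is the piecewise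 constant function with value $\theta^m_j$ on $I_j$, where $\boldsymbol{h}^m_j=|\boldsymbol{h}^m_j|(\cos\theta^m_j,\sin\theta^m_j)^T$. For $f\in\mathbb{K}^h$ (or vector-valued) the discrete derivative on $\Gamma^m$ is $\partial_sf|_{I_j}=\dfrac{f(\rho_j)-f(\rho_{j-1})}{|\boldsymbol{h}^m_j|}$. The mass-lumped inner product, for scalar or vector functions continuous on the interior of each $I_j$ with one-sided limits, is $$\bigl(u,v\bigr)^h_{\Gamma^m}=\frac12\sum_{j=1}^N|\boldsymbol{h}^m_j|\left((u\cdot v)(\rho_{j-1}^+)+(u\cdot v)(\rho_j^-)\right).$$ SPFEM for solid-state dewetting: let $\boldsymbol{X}^0\in\mathbb{X}^h$ be given by $\boldsymbol{X}^0(\rho_j)=\boldsymbol{X}_0(\rho_j)$, $0\le j\le N$, for an open initial curve $\boldsymbol{X}_0$ with endpoints on the $x$-axis. For $m=0,1,2,\dots$ find $(\boldsymbol{X}^{m+1},\mu^{m+1})\in\mathbb{X}^h\times\mathbb{K}^h$ such that $$\Bigl(\boldsymbol{n}^{m+\frac12}\cdot\tfrac{\boldsymbol{X}^{m+1}-\boldsymbol{X}^m}{\tau},\varphi^h\Bigr)^h_{\Gamma^m}+\Bigl(\partial_s\mu^{m+1},\partial_s\varphi^h\Bigr)^h_{\Gamma^m}=0,\quad\forall\varphi^h\in\mathbb{K}^h,$$ $$\Bigl(\mu^{m+1}\boldsymbol{n}^{m+\frac12},\boldsymbol{\omega}^h\Bigr)^h_{\Gamma^m}-\Bigl(\hat{\boldsymbol{G}}_k(\theta^m)\partial_s\boldsymbol{X}^{m+1},\partial_s\boldsymbol{\omega}^h\Bigr)^h_{\Gamma^m}-\frac1\eta\left[\frac{x_l^{m+1}-x_l^m}{\tau}\omega_1^h(0)+\frac{x_r^{m+1}-x_r^m}{\tau}\omega_1^h(1)\right]+\sigma\left[\omega_1^h(1)-\omega_1^h(0)\right]=0$$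 for all $\boldsymbol{\omega}^h=(\omega_1^h,\omega_2^h)^T\in\mathbb{X}^h$, and satisfying $x_l^{m+1}\le x_r^{m+1}$, where $\boldsymbol{n}^{m+\frac12}=-\frac12\frac{1}{|\partial_\rho\boldsymbol{X}^m|}(\partial_\rho\boldsymbol{X}^m+\partial_\rho\boldsymbol{X}^{m+1})^\perp$ (piecewise constant). Discrete area and energy: $$A^m_o=\frac12\sum_{j=1}^N\left(x^m(\rho_j)-x^m(\rho_{j-1})\right)\left(y^m(\rho_j)+y^m(\rho_{j-1})\right),\qquad W^m_o=\sum_{j=1}^N|\boldsymbol{h}^m_j|\,\hat\gamma(\theta^m_j)-\sigma\,(x_r^m-x_l^m).$$ *)

(* Defs.v *)
From HB Require Import structures.
From mathcomp Require Import all_boot all_order all_algebra.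
From mathcomp Require Import all_classical all_reals all_analysis.

Set Implicit Arguments.
Unset Strict Implicit.
Unset Printing Implicit Defensive.

Import Order.TTheory GRing.Theory Num.Theory.
Import numFieldNormedType.Exports.

Local Open Scope ring_scope.
Local Open Scope classical_set_scope.

(* A function on the circle R / 2 pi Z is a 2 pi-periodic function on R, and a
   function on [0, 1] is a function on R whose values outside [0, 1] are
   irrelevant. *)

Section Plane.
Variable R : realType.

Definition vec2 (a b : R) : 'cV[R]_2 := \col_i [:: a; b]`_i.

Definition mat2 (a b c d : R) : 'M[R]_2 :=
  \matrix_(i, j) (nth [::] [:: [:: a; b]; [:: c; d]] i)`_j.

Definition xc (v : 'cV[R]_2) : R := v 0 0.
Definition yc (v : 'cV[R]_2) : R := v 1 0.

Definition dot (u v : 'cV[R]_2) : R := xc u * xc v + yc u * yc v.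

(* The library norm on matrices is the sup norm, hence this definition. *)
Definition enorm (v : 'cV[R]_2) : R := Num.sqrt (dot v v).

Definition perp (v : 'cV[R]_2) : 'cV[R]_2 := vec2 (yc v) (- xc v).

End Plane.

Arguments xc {R} v.
Arguments yc {R} v.

Section SurfaceEnergy.
Variable R : realType.
Implicit Types f gamma k : R -> R.

Definition circle_fun f : Prop := periodic f (pi *+ 2).

Definition circle_C1 f : Prop :=
  (forall t, derivable f t 1) /\ continuous f^`().

(* Derivative relative to A: one-sided at an endpoint of an interval. *)
Definition deriv_within (A : set R) f (x l : R) : Prop :=
  (f y - f x) / (y - x) @[y --> within A x^'] --> l.

Definition C2_on (a b : R) f : Prop :=
  exists f1 f2 : R -> R,
    [/\ forall x, a <= x <= b -> deriv_within `[a, b] f x (f1 x),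
        forall x, a <= x <= b -> deriv_within `[a, b] f1 x (f2 x) &
        {within `[a, b], continuous f2}].

Definition circle_piecewise_C2 f : Prop :=
  exists (p : nat) (a : nat -> R),
    [/\ (0 < p)%N, a p = a 0%N + pi *+ 2 &
        forall i, (i < p)%N -> a i < a i.+1 /\ C2_on (a i) (a i.+1) f].

Definition Gk gamma k (t : R) : 'M[R]_2 :=
  mat2 (gamma t) (- gamma^`()%classic t)
       (gamma^`()%classic t) (gamma t)
  + k t *: mat2 (sin t ^+ 2) (- (cos t * sin t))
                (- (cos t * sin t)) (cos t ^+ 2).

End SurfaceEnergy.

Section FiniteElements.
Variables (R : realType) (N : nat).
Implicit Types (u v : R -> R) (X Y : R -> 'cV[R]_2).

Definition rho (j : nat) : R := j%:R / N%:R.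

Definition Kh u : Prop :=
  {within `[0, 1], continuous u} /\
  forall j, (1 <= j <= N)%N ->
    exists a b : R, forall r, rho j.-1 <= r <= rho j -> u r = a + b * r.

Definition Kh0 u : Prop := [/\ Kh u, u 0 = 0 & u 1 = 0].

Definition Xh X : Prop := Kh (xc \o X) /\ Kh0 (yc \o X).

(* The step function equal to c j on the interior of the j-th element
   (rho (j - 1), rho j), for 1 <= j <= N. *)
Definition step {T : Type} (c : nat -> T) (r : R) : T :=
  c (Num.truncn (r * N%:R)).+1.

Definition edge X (j : nat) : 'cV[R]_2 := X (rho j) - X (rho j.-1).

Definition is_angle X (theta : nat -> R) : Prop :=
  forall j, (1 <= j <= N)%N ->
    edge X j = enorm (edge X j) *: vec2 (cos (theta j)) (sin (theta j)).

Definition ds X u : R -> R :=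
  step (fun j => (u (rho j) - u (rho j.-1)) / enorm (edge X j)).

Definition dsv X Y : R -> 'cV[R]_2 :=
  step (fun j => (enorm (edge X j))^-1 *: (Y (rho j) - Y (rho j.-1))).

(* Mass lumping of a product u . v given as a single integrand g. *)
Definition lumped X (g : R -> R) : R :=
  2^-1 * \sum_(1 <= j < N.+1)
    enorm (edge X j) * (lim (g r @[r --> (rho j.-1)^'+])
                        + lim (g r @[r --> (rho j)^'-])).

Definition ip X u v : R := lumped X (fun r => u r * v r).

Definition ipv X Y Z : R := lumped X (fun r => dot (Y r) (Z r)).

Definition drho X (r : R) : 'cV[R]_2 :=
  vec2 ((xc \o X)^`()%classic r) ((yc \o X)^`()%classic r).

(* n^(m+1/2) for X = X^m and X' = X^(m+1) *)
Definition nhalf X X' (r : R) : 'cV[R]_2 :=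
  - (2^-1 * (enorm (drho X r))^-1) *: perp (drho X r + drho X' r).

Definition area X : R :=
  2^-1 * \sum_(1 <= j < N.+1)
    (xc (X (rho j)) - xc (X (rho j.-1))) * (yc (X (rho j)) + yc (X (rho j.-1))).

Definition energy (gamma : R -> R) (sigma : R) X (theta : nat -> R) : R :=
  \sum_(1 <= j < N.+1) enorm (edge X j) * gamma (theta j)
  - sigma * (xc (X 1) - xc (X 0)).

Definition spfem_step (gamma k : R -> R) (sigma eta tau : R)
    X (theta : nat -> R) X' (mu' : R -> R) : Prop :=
  [/\ Xh X', Kh mu',
      forall phi, Kh phi ->
        ip X (fun r => dot (nhalf X X' r) (tau^-1 *: (X' r - X r))) phi
        + ip X (ds X mu') (ds X phi) = 0,
      forall omega, Xh omega ->
        ipv X (fun r => mu' r *: nhalf X X' r) omega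
        - ipv X (fun r => Gk gamma k (step theta r) *m dsv X X' r)
                (dsv X omega)
        - eta^-1 * ((xc (X' 0) - xc (X 0)) / tau * xc (omega 0)
                    + (xc (X' 1) - xc (X 1)) / tau * xc (omega 1))
        + sigma * (xc (omega 1) - xc (omega 0)) = 0 &
      xc (X' 0) <= xc (X' 1)].

(* theta m j is a representative in R of the angle of the j-th edge of X m. *)
Record spfem_solution (gamma k : R -> R) (sigma eta tau : R)
    (Xinit : R -> 'cV[R]_2) (X : nat -> R -> 'cV[R]_2)
    (mu : nat -> R -> R) (theta : nat -> nat -> R) : Prop := {
  spfem_X0 : Xh (X 0%N);
  spfem_interp : forall j, (j <= N)%N -> X 0%N (rho j) = Xinit (rho j);
  spfem_edge : forall m j, (1 <= j <= N)%N -> edge (X m) j != 0;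
  spfem_angle : forall m, is_angle (X m) (theta m);
  spfem_eq : forall m,
    spfem_step gamma k sigma eta tau (X m) (theta m) (X m.+1) (mu m.+1) }.

End FiniteElements.

Definition open_curve (R : realType) (X : R -> 'cV[R]_2) : Prop :=
  [/\ {within `[0, 1], continuous (xc \o X)},
      {within `[0, 1], continuous (yc \o X)},
      yc (X 0) = 0 & yc (X 1) = 0].

(* Main.v *)
Require Import Defs.
From HB Require Import structures.
From mathcomp Require Import all_boot all_order all_algebra.
From mathcomp Require Import all_classical all_reals all_analysis.
From mathcomp Require Import ring lra.

Set Implicit Arguments.
Unset Strict Implicit.
Unset Printing Implicit Defensive.

Import Order.TTheory GRing.Theory Num.Theory.
Import numFieldNormedType.Exports.

Local Open Scope ring_scope.
Local Open Scope classical_set_scope.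

(** Conservation of the area follows from the first equation tested with the
    constant function [1]: the normal at the half step makes each element
    contribute its exact change of area up to a telescoping term that vanishes at
    the endpoints, where both curves are on the axis ([velocity_form1]).

    For the energy, the first equation is tested with the chemical potential and
    the second one with the displacement of the curve.  This shows that the
    stiffness term, minus the contribution of the contact angle, is nonpositive,
    because the dissipation of the chemical potential and the friction of the
    contact points have a sign ([energy_step]).  It remains to bound the change
    of surface energy of each edge by its stiffness term ([edge_energy]).  If an
    edge of angle [t] is rotated by [d] and its length multiplied by [r], this
    means
      [gamma t * r ^+ 2 + k t * sin d ^+ 2 * r ^+ 2 - r * Q d + gamma t >= 0],
      [Q d = gamma (t + d) + gamma t * cos d - gamma^`() t * sin d],
    and by a discriminant computation it suffices, for large [k t], that
    [Q d <= 2 * gamma t + K * sin d ^+ 2] for some constant [K] and all [d]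
    ([admissible_neq0]).

    Such a [K] exists near any [d] with [sin d != 0], by continuity.  At [d = 0]
    the two sides touch, with zero slope on both, and piecewise regularity of
    class C2 bounds the difference by a quadratic, hence by the squared sine.  At
    [d = pi] hypothesis (a) gives [Q pi <= 2 * gamma t]; in case of equality,
    hypothesis (b) and the minimality of [3 * gamma s - gamma (s - pi)] at
    [s = t] make the slope of [Q] vanish, and the same quadratic bound applies
    ([linear_coef_contact], [linear_coef_local]).  Compactness of the circle gives
    one [K] for all [d] ([linear_coef_bound]).  The constant may depend on [t] in
    any way, so no uniformity in [t] is sought; [kmin] chooses one value for each
    [t]. *)

(** * Derivatives relative to a segment *)

Section DerivWithin.
Variable R : realType.
Implicit Types (f : R -> R) (A B : set R).

Lemma deriv_within_sub A B f x l :
  A `<=` B -> deriv_within B f x l -> deriv_within A f x l.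
Proof.
move=> AB H P /H; rewrite /= /within /nbhs /=.
by apply: filterS => y + /AB; apply.
Qed.

Lemma derivable_deriv_within A f x :
  derivable f x 1 -> deriv_within A f x (f^`()%classic x).
Proof.
move=> dfx; apply: (deriv_within_sub (@subsetT _ A)).
apply/cvgrPdist_lt => e e0.
have /cvgrPdist_lt/(_ e e0) := dfx.
rewrite -[lim _]derive1E !near_withinE => H.
suff : \forall y \near x, y != x -> [set: R] y ->
  `|f^`()%classic x - (f y - f x) / (y - x)| < e by [].
rewrite (near_shift (0 : R) x); move: H; apply: filterS => h /= H hx _.
have h0 : h != 0 by apply: contra hx => /eqP ->; rewrite subr0 add0r.
move: (H h0); rewrite [h%:A]mulr1 subr0 addrK.
by rewrite [_ *: _]mulrC.
Qed.

Lemma deriv_within_lipschitz A f x l : deriv_within A f x l ->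
  exists C, \forall y \near x, A y -> `|f y - f x| <= C * `|y - x|.
Proof.
move=> /cvgrPdist_lt/(_ 1 ltr01); rewrite !near_withinE => H.
exists (`|l| + 1); move: H; apply: filterS => y H Ay.
have [->|yx] := eqVneq y x; first by rewrite !subrr normr0 mulr0.
have q0 : y - x != 0 by rewrite subr_eq0.
have -> : f y - f x = (f y - f x) / (y - x) * (y - x) by rewrite divfK.
rewrite normrM ler_wpM2r//.
rewrite -[(_ / _)](subKr l).
apply: le_trans (ler_normB _ _) _.
by rewrite lerD2l ltW// H.
Qed.

Lemma derivable_lipschitz (f : R -> R) (x : R) : derivable f x 1 ->
  exists C, \forall y \near x, `|f y - f x| <= C * `|y - x|.
Proof.
move=> /(derivable_deriv_within setT)/deriv_within_lipschitz[C H].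
by exists C; move: H; apply: filterS => y; apply.
Qed.

Lemma segment_dnbhs_proper (a b x : R) : a < b -> a <= x <= b ->
  ProperFilter (within `[a, b] x^').
Proof.
move=> ab /andP[ax xb]; split; last exact: within_filter.
rewrite /within/= => /nbhs_ballP[e /= e0 H].
have e2 : 0 < e / 2 by rewrite divr_gt0.
have bad y : y != x -> a <= y <= b -> `|x - y| < e -> False.
  by move=> yx yab xye; apply: (H y) => //=; rewrite in_itv.
have [xltb|bx] := ltP x b.
  have [h|h] := leP (x + e / 2) b.
    apply: (bad (x + e / 2)); rewrite ?gt_eqF ?ltrDl//; first by apply/andP; lra.
    by rewrite opprD addrA subrr sub0r normrN gtr0_norm//; lra.
  apply: (bad b); rewrite ?gt_eqF//; first by apply/andP; lra.
  by rewrite distrC gtr0_norm; lra.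
have xb' : x = b by apply/eqP; rewrite eq_le xb bx.
have [h|h] := leP a (x - e / 2).
  apply: (bad (x - e / 2)); rewrite ?lt_eqF ?ltrBlDr ?ltrDl//.
    by apply/andP; lra.
  by rewrite subKr gtr0_norm//; lra.
apply: (bad a); first by rewrite lt_eqF// xb'.
  by apply/andP; lra.
by rewrite gtr0_norm; lra.
Qed.

Lemma deriv_within_segment_unique (a b x l l' : R) f :
  a < b -> a <= x <= b ->
  deriv_within `[a, b] f x l -> deriv_within `[a, b] f x l' -> l = l'.
Proof.
move=> ab xab dl dl'; have P := segment_dnbhs_proper ab xab.
exact: cvg_unique dl dl'.
Qed.

(** One-sided and two-sided derivatives agree on the arc, so the witness [f1] of
    [C2_on] is the derivative of [f]; being itself differentiable at [x] relative
    to the arc, it is Lipschitz at [x]. *)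
Lemma C2_on_derive1_lipschitz a b f x :
    (forall t, derivable f t 1) -> a < b -> a <= x <= b -> C2_on a b f ->
  exists C, \forall y \near x, a <= y <= b ->
    `|f^`()%classic y - f^`()%classic x| <= C * `|y - x|.
Proof.
move=> df ab xab [f1 [f2 [H1 H2 _]]].
have f1E y : a <= y <= b -> f1 y = f^`()%classic y.
  move=> yab; apply: (deriv_within_segment_unique ab yab (H1 y yab)).
  exact: derivable_deriv_within.
have [C HC] := deriv_within_lipschitz (H2 x xab); exists C.
move: HC; apply: filterS => y H yab.
by rewrite -!f1E//; apply: H; rewrite /= in_itv.
Qed.

End DerivWithin.

(** * Periodic functions *)

Section Periodic.
Variable R : realType.
Implicit Types f : R -> R.

Lemma periodic_int f (T : R) (z : int) x : periodic f T ->
  f (x + z%:~R * T) = f x.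
Proof.
move=> fT; case: z => n.
  by rewrite -pmulrn mulr_natl periodicn.
rewrite NegzE mulrNz mulNr -[X in _ = f X](subrK (n.+1%:~R * T)).
by rewrite -pmulrn mulr_natl (periodicn fT).
Qed.

Lemma period_shift (a T x : R) : 0 < T ->
  exists z : int, a <= x + z%:~R * T < a + T.
Proof.
move=> T0; exists (- Num.Def.floor ((x - a) / T)).
have /andP[h1 h2] := floor_itv ((x - a) / T).
rewrite mulrNz mulNr; move: h1 h2.
rewrite intrD mulr1z ler_pdivlMr// ltr_pdivrMr//.
rewrite [(_ + 1) * T]mulrDl mul1r => h1 h2.
by apply/andP; lra.
Qed.

Lemma periodic_derive1 f (T : R) : periodic f T -> periodic f^`()%classic T.
Proof.
move=> fT x; rewrite /derive1; congr (lim _).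
set u := (u in u @ _ = _); set v := (v in _ = v @ _).
by have -> : u = v by apply: funext => h; rewrite /u /v addrA !fT.
Qed.
Lemma sin_eq0_shift (d : R) : sin d = 0 -> exists z : int,
  d + z%:~R * (pi *+ 2) = 0 \/ d + z%:~R * (pi *+ 2) = pi.
Proof.
have p0 := pi_gt0 R.
have T0 : 0 < pi *+ 2 :> R by rewrite pmulrn_lgt0.
have [z] := period_shift 0 d T0; rewrite add0r => /andP[e1 e2] sd.
exists z; have : sin (d + z%:~R * (pi *+ 2)) = 0.
  by rewrite (periodic_int z _ (@sinD2pi R)).
move: e1 e2; set e := d + _; rewrite mulr2n => e1 e2 se.
have [->|e0] := eqVneq e 0; [by left | right].
have {e0 e1} e0 : 0 < e by rewrite lt_def e0.
apply/eqP; rewrite eq_le; apply/andP; split; rewrite leNgt; apply/negP => ep.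
  have := @sin_gt0_pi R (e - pi).
  rewrite sinB sinpi cospi se mul0r mulr0 subr0 ltxx => H.
  by have : false by apply: H; apply/andP; lra.
by have := @sin_gt0_pi R e; rewrite e0 ep se ltxx => /(_ isT).
Qed.

End Periodic.

(** * Quadratic estimates at a single point *)

Section LocalBounds.
Variable R : realType.
Implicit Types f : R -> R.

(** By the mean value theorem: at an intermediate point [c] the derivative is at
    most [`|C| * `|c - x|], hence at most [`|C| * `|y - x|]. *)
Lemma quadratic_bound f (df : R -> R) (x C : R) :
    (forall t : R, is_derive t 1 f (df t)) -> df x = 0 ->
    (\forall y \near x, `|df y - df x| <= C * `|y - x|) ->
  \forall y \near x, f y <= f x + `|C| * (y - x) ^+ 2.
Proof.
move=> fdf df0 /nbhs_ballP[e /= e0 H].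
apply/nbhs_ballP; exists e => //= y xy.
have cf (a b : R) : {within `[a, b], continuous f}.
  apply: continuous_subspaceT => z; apply: differentiable_continuous.
  by apply/derivable1_diffP; have [] := fdf z.
have dfle c : `|c - x| <= `|y - x| -> `|df c| <= `|C| * `|y - x|.
  move=> cy; have := H c; rewrite df0 subr0 /ball /= => /(_ _) h.
  apply: le_trans (h _) _.
    by rewrite distrC (le_lt_trans cy)// distrC.
  apply: (le_trans (ler_norm _)); rewrite normrM normr_id.
  by rewrite ler_wpM2l.
suff [c cy E] : exists2 c, `|c - x| <= `|y - x| & f y - f x = df c * (y - x).
  rewrite -lerBlDl E -(real_normK (num_real (y - x))) expr2 mulrA.
  apply: (le_trans (ler_norm _)); rewrite normrM ler_wpM2r//.
  exact: dfle.
have [yx|yx|->] := ltgtP y x.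
- have [c] := MVT yx (fun z _ => fdf z) (cf y x).
  rewrite in_itv/= => /andP[h1 h2] E; exists c.
    by rewrite !ltr0_norm ?subr_lt0//; lra.
  by rewrite -[LHS]opprB E -mulrN opprB.
- have [c] := MVT yx (fun z _ => fdf z) (cf x y).
  rewrite in_itv/= => /andP[h1 h2] E; exists c => //.
  by rewrite !gtr0_norm ?subr_gt0//; lra.
- by exists x => //; rewrite !subrr mulr0.
Qed.

(** At a zero of the sine the slope is [1] or [-1], so the difference quotient
    exceeds [1/2] in absolute value nearby. *)
Lemma sqr_le_sin2 (x : R) : sin x = 0 ->
  \forall y \near x, (y - x) ^+ 2 <= 4 * sin y ^+ 2.
Proof.
move=> sx0.
have [dx e] := is_derive_sin x.
have := derivable_deriv_within setT dx; rewrite derive1E e.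
move=> /cvgrPdist_lt/(_ (2^-1)); rewrite invr_gt0 ltr0n => /(_ isT).
rewrite !near_withinE; apply: filterS => y H.
have [->|yx] := eqVneq y x; first by rewrite subrr expr0n mulr_ge0 ?sqr_ge0.
have := H yx I; rewrite sx0 subr0.
have c2 : cos x ^+ 2 = 1 by have := cos2Dsin2 x; rewrite sx0; lra.
set q := sin y / (y - x) => hq.
have -> : sin y = q * (y - x) by rewrite divfK// subr_eq0.
have q2 : 1 <= 4 * q ^+ 2.
  move: hq; rewrite ltr_norml => /andP[h1 h2].
  have [c1|c1] : cos x = 1 \/ cos x = -1.
    by have := c2 => /eqP; rewrite sqrf_eq1 => /orP[] /eqP; [left|right].
  - by rewrite c1 in h1 h2; nra.
  - by rewrite c1 in h1 h2; nra.
by rewrite exprMn; have := sqr_ge0 (y - x); nra.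
Qed.

Lemma lipschitz_shift f (T x C : R) (z : int) (P : R -> Prop) :
    periodic f T ->
    (\forall y \near x + z%:~R * T, P y ->
        `|f y - f (x + z%:~R * T)| <= C * `|y - (x + z%:~R * T)|) ->
  \forall y \near x, P (y + z%:~R * T) -> `|f y - f x| <= C * `|y - x|.
Proof.
move=> fT; rewrite (near_shift x); apply: filterS => y /= H Py.
have E : y + (x + z%:~R * T - x) = y + z%:~R * T by lra.
rewrite E !(periodic_int z _ fT) in H.
by have := H Py; congr (_ <= _ * `|_|); lra.
Qed.

(** A breakpoint belongs to two arcs. The next two lemmas pick the arc that
    extends to the right of [x], respectively to the left. *)
Lemma subdivision_right (a : nat -> R) p x : a 0%N <= x < a p ->
  exists2 i, (i < p)%N & a i <= x < a i.+1.
Proof.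
elim: p => [|p IH] /andP[h1 h2]; first by exfalso; lra.
have [xp|xp] := ltP x (a p); last by exists p => //; rewrite xp.
by have [|i ip h] := IH; [rewrite h1|exists i => //; exact: ltnW].
Qed.

Lemma subdivision_left (a : nat -> R) p x : a 0%N < x <= a p ->
  exists2 i, (i < p)%N & a i < x <= a i.+1.
Proof.
elim: p => [|p IH] /andP[h1 h2]; first by exfalso; lra.
have [xp|xp] := leP x (a p); last by exists p => //; rewrite xp.
by have [|i ip h] := IH; [rewrite h1|exists i => //; exact: ltnW].
Qed.

(** A kink of the derivative at a breakpoint does no harm: the two adjacent arcs
    give a bound on either side. *)
Lemma piecewise_C2_lipschitz f x :
    circle_fun f -> circle_C1 f -> circle_piecewise_C2 f ->
  exists C, \forall y \near x,
    `|f^`()%classic y - f^`()%classic x| <= C * `|y - x|.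
Proof.
move=> fT [df _] [p [a [p0 ap H]]].
have T0 : 0 < pi *+ 2 :> R by rewrite pmulrn_lgt0// pi_gt0.
have dT := periodic_derive1 fT.
have [C1 HC1] : exists C, \forall y \near x, x <= y ->
    `|f^`()%classic y - f^`()%classic x| <= C * `|y - x|.
  have [z] := period_shift (a 0%N) x T0; rewrite -ap.
  move=> /subdivision_right[i /H[ab c2]] /andP[xa xb].
  have [|C HC] := C2_on_derive1_lipschitz df ab _ c2 (x := x + z%:~R * (pi *+ 2)).
    by rewrite xa ltW.
  exists C; have := lipschitz_shift dT HC.
  have : \forall y \near x, y < a i.+1 - z%:~R * (pi *+ 2).
    by apply: lt_nbhsl; lra.
  by apply: filterS2 => y h1 h2 xy; apply: h2; apply/andP; lra.
have [C2 HC2] : exists C, \forall y \near x, y <= x ->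
    `|f^`()%classic y - f^`()%classic x| <= C * `|y - x|.
  have [z /andP[z1 z2]] := period_shift (- (a 0%N + pi *+ 2)) (- x) T0.
  have : a 0%N < x + (- z)%:~R * (pi *+ 2) <= a p.
    by rewrite ap mulrNz; apply/andP; lra.
  move=> /subdivision_left[i /H[ab c2]] /andP[xa xb].
  have [|C HC] := C2_on_derive1_lipschitz df ab _ c2
      (x := x + (- z)%:~R * (pi *+ 2)).
    by rewrite xb ltW.
  exists C; have := lipschitz_shift dT HC.
  have : \forall y \near x, a i - (- z)%:~R * (pi *+ 2) < y.
    by apply: lt_nbhsr; lra.
  by apply: filterS2 => y h1 h2 xy; apply: h2; apply/andP; lra.
exists (Num.max C1 C2); move: HC1 HC2; apply: filterS2 => y h1 h2.
have [xy|/ltW yx] := leP x y.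
  by apply: le_trans (h1 xy) _; rewrite ler_wpM2r// le_max lexx.
by apply: le_trans (h2 yx) _; rewrite ler_wpM2r// le_max lexx orbT.
Qed.

End LocalBounds.

(** * The minimal stabilizing function *)

Section Stabilizer.
Variables (R : realType) (gamma : R -> R).
Hypothesis gamma_circle : circle_fun gamma.
Hypothesis gamma_gt0 : forall t, 0 < gamma t.
Hypothesis gamma_C1 : circle_C1 gamma.
Hypothesis gamma_C2 : circle_piecewise_C2 gamma.
Hypothesis gamma_3 : forall t, gamma (t - pi) <= 3 * gamma t.
Hypothesis gamma_eq :
  forall t, 3 * gamma t = gamma (t - pi) -> gamma^`() t = 0.

Let dgamma : R -> R := gamma^`()%classic.

(** For an edge of angle [t] that becomes an edge of angle [t + d] and [r] times
    its length, this is the coefficient of [- r] in the difference between the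
    discrete form and the change of surface energy. *)
Definition linear_coef (t d : R) : R :=
  gamma (t + d) + gamma t * cos d - gamma^`()%classic t * sin d.

Lemma is_derive_gamma (t : R) : is_derive t 1 gamma (dgamma t).
Proof. by split; [apply gamma_C1.1 | rewrite /dgamma derive1E]. Qed.

Lemma is_derive_linear_coef (t d : R) :
  is_derive d 1 (linear_coef t)
    (dgamma (t + d) - gamma t * sin d - dgamma t * cos d).
Proof.
have H1 : is_derive d 1 (fun e => gamma (t + e)) (dgamma (t + d)).
  have := is_derive_gamma (t + d) => H.
  have := @is_derive1_comp _ gamma (fun e => t + e) d (dgamma (t + d)) 1 H.
  rewrite mulr1; apply.
  by have := is_deriveD (is_derive_cst t d 1) (is_derive_id d 1); rewrite add0r.
have H2 : is_derive d 1 (fun e => gamma t * cos e) (gamma t * - sin d).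
  exact: (is_deriveZ (gamma t) (is_derive_cos d)).
have H3 : is_derive d 1 (fun e => dgamma t * sin e) (dgamma t * cos d).
  exact: (is_deriveZ (dgamma t) (is_derive_sin d)).
have := is_deriveB (is_deriveD H1 H2) H3.
by rewrite mulrN.
Qed.

Lemma derive_linear_coef_lipschitz (t d : R) (dQ := fun e =>
    dgamma (t + e) - gamma t * sin e - dgamma t * cos e) :
  exists C, \forall e \near d, `|dQ e - dQ d| <= C * `|e - d|.
Proof.
have [C1 H1] := piecewise_C2_lipschitz (t + d) gamma_circle gamma_C1 gamma_C2.
have [C2 H2] : exists C, \forall y \near d, `|sin y - sin d| <= C * `|y - d|.
  by apply: derivable_lipschitz; apply: ex_derive.
have [C3 H3] : exists C, \forall y \near d, `|cos y - cos d| <= C * `|y - d|.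
  by apply: derivable_lipschitz; apply: ex_derive.
exists (C1 + gamma t * C2 + `|dgamma t| * C3).
move: H1; rewrite (near_shift d); move: H2 H3; apply: filterS3.
move=> e h2 h3 /= h1.
have E : e + (t + d - d) = t + e by lra.
rewrite E in h1.
have -> : dQ e - dQ d = (dgamma (t + e) - dgamma (t + d))
  - gamma t * (sin e - sin d) - dgamma t * (cos e - cos d) by rewrite /dQ; ring.
rewrite !mulrDl; apply: (le_trans (ler_normB _ _)); apply: lerD.
  apply: (le_trans (ler_normB _ _)); apply: lerD.
    by apply: (le_trans h1); rewrite (_ : t + e - (t + d) = e - d)//; ring.
  by rewrite normrM gtr0_norm// -mulrA ler_wpM2l// ltW.
by rewrite normrM -mulrA ler_wpM2l.
Qed.

(** Where the sine vanishes the stabilizer gives no help, so [linear_coef t]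
    must not exceed [2 * gamma t] there, and must have zero slope if it equals
    it.  For a multiple of [2 * pi] contact is automatic.  For an odd multiple of
    [pi] it means that [3 * gamma t = gamma (t - pi)]; then [t] minimizes the
    nonnegative function [3 * gamma s - gamma (s - pi)], so the derivative of
    [gamma] at [t - pi] is three times that at [t], hence zero. *)
Lemma linear_coef_contact (t d : R) : sin d = 0 ->
  linear_coef t d < 2 * gamma t \/
  (linear_coef t d = 2 * gamma t /\
   dgamma (t + d) - gamma t * sin d - dgamma t * cos d = 0).
Proof.
have per (f : R -> R) : circle_fun f ->
    forall (z : int) x, f (x + z%:~R * (pi *+ 2)) = f x.
  by move=> fT z x; exact: periodic_int.
have dT := periodic_derive1 gamma_circle.
move=> /sin_eq0_shift[z dz].
have E (f : R -> R) : circle_fun f ->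
    forall x, f (x + d) = f (x + (d + z%:~R * (pi *+ 2))).
  by move=> fT x; rewrite addrA (per f fT).
have cd := E cos (@cosD2pi R) 0; have sd := E sin (@sinD2pi R) 0.
rewrite !add0r in cd sd.
rewrite /linear_coef /dgamma (E _ gamma_circle t) (E _ dT t) cd sd.
case: dz => ->; rewrite ?cos0 ?sin0 ?cospi ?sinpi ?addr0.
  by right; split; lra.
have piE (f : R -> R) : circle_fun f -> f (t + pi) = f (t - pi).
  move=> fT; rewrite -(fT (t - pi)); congr f; rewrite mulr2n; lra.
rewrite (piE _ gamma_circle) (piE _ dT).
have := gamma_3 t; rewrite le_eqVlt => /orP[/eqP eq|lt]; last by left; lra.
have dt0 : gamma^`()%classic t = 0 by apply: gamma_eq; lra.
right; split; first by lra.
pose F (s : R) := 3 * gamma s - gamma (s - pi).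
have dF (s : R) : is_derive s 1 F (3 * dgamma s - dgamma (s - pi)).
  have h1 := is_deriveZ 3 (is_derive_gamma s).
  have h2 : is_derive s 1 (fun s : R => s - pi) 1.
    by have := is_deriveB (is_derive_id s 1) (is_derive_cst pi s 1); rewrite subr0.
  have h3 := @is_derive1_comp R gamma (fun u : R => u - pi) s _ 1
    (is_derive_gamma (s - pi)) h2.
  by have := is_deriveB h1 h3; rewrite mulr1.
have [_ e1] := dF t.
have tI : t \in `](t - 1), (t + 1)[%R by rewrite in_itv/=; apply/andP; lra.
have [|s _|s _|_ e2] := derive1_at_min (f := F) _ _ tI.
- by lra.
- by have [] := dF s.
- by rewrite /F eq subrr subr_ge0.
move: e1; rewrite e2 /dgamma; lra.
Qed.

(** Away from the zeros of the sine, continuity is enough. At a zero of the sine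
    either the inequality is strict, or [quadratic_bound] and [sqr_le_sin2]
    compare both sides with the square of the distance to the contact point. *)
Lemma linear_coef_local (t d : R) : exists C, \forall e \near d,
  linear_coef t e <= 2 * gamma t + C * sin e ^+ 2.
Proof.
have cQ : {for d, continuous (linear_coef t)}.
  apply/differentiable_continuous/derivable1_diffP.
  by have [] := is_derive_linear_coef t d.
have [s0|s0] := eqVneq (sin d) 0; last first.
  exists ((`|linear_coef t d| + 1) * (2 / sin d ^+ 2)).
  have s2 : 0 < sin d ^+ 2 by rewrite lt_def sqr_ge0 expf_neq0.
  have cs : {for d, continuous (fun e : R => sin e ^+ 2)}.
    exact: (@continuous_comp _ _ _ (@sin R) (fun x : R => x ^+ 2) d
      (@continuous_sin R d) (@exprn_continuous R 2 _)).
  have h1 : \forall e \near d, linear_coef t e < `|linear_coef t d| + 1.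
    apply: (cvgr_lt (linear_coef t d) cQ).
    by rewrite (le_lt_trans (ler_norm _))// ltrDl.
  have h2 : \forall e \near d, sin d ^+ 2 / 2 < sin e ^+ 2.
    apply: (cvgr_gt (sin d ^+ 2) cs).
    by rewrite ltr_pdivrMr// ltr_pMr// ltr1n.
  move: h1 h2; apply: filterS2 => e h1 h2.
  apply: (le_trans (ltW h1)); rewrite -mulrA.
  have g0 := gamma_gt0 t.
  have : 1 <= 2 / sin d ^+ 2 * sin e ^+ 2.
    by rewrite mulrAC ler_pdivlMr// mul1r; lra.
  have : 0 <= `|linear_coef t d| + 1 by rewrite addr_ge0.
  by nra.
have [lt|[eq dQ0]] := linear_coef_contact t s0.
  exists 0; have : \forall e \near d, linear_coef t e < 2 * gamma t.
    exact: (cvgr_lt (linear_coef t d) cQ).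
  by apply: filterS => e /ltW; rewrite mul0r addr0.
have [C HC] := derive_linear_coef_lipschitz t d.
have Hq := quadratic_bound (is_derive_linear_coef t) dQ0 HC.
exists (`|C| * 4); move: Hq (sqr_le_sin2 s0); apply: filterS2 => e hq hs.
by apply: (le_trans hq); rewrite eq lerD2l -mulrA ler_wpM2l.
Qed.

(** The local constants are made uniform by compactness of a period: the bound
    is monotone in [K], hence holds for all [K] near [+oo]. *)
Lemma linear_coef_bound (t : R) : exists2 K, 0 <= K &
  forall d, linear_coef t d <= 2 * gamma t + K * sin d ^+ 2.
Proof.
have T0 : 0 < pi *+ 2 :> R by rewrite pmulrn_lgt0// pi_gt0.
have := @segment_compact R 0 (pi *+ 2).
move=> /compact_near_coveringP/(_ R +oo (fun K d =>
  linear_coef t d <= 2 * gamma t + K * sin d ^+ 2)) H.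
have {}H := H _.
have /H {}H : forall d, `[0, pi *+ 2]%classic d ->
    \forall e \near d & K \near +oo,
      linear_coef t e <= 2 * gamma t + K * sin e ^+ 2.
  move=> d _; have [C HC] := linear_coef_local t d.
  exists ([set e | linear_coef t e <= 2 * gamma t + C * sin e ^+ 2],
          [set K | C <= K]).
    by split=> //=; apply: nbhs_pinfty_ge; rewrite num_real.
  move=> [e K] /= [h1 h2]; apply: (le_trans h1).
  by rewrite lerD2l ler_wpM2r ?sqr_ge0.
have : \forall K \near +oo, 0 <= K :> R.
  by apply: nbhs_pinfty_ge; rewrite num_real.
move=> /(filterI H)/filter_ex[K [HK K0]]; exists K => // d.
have [z] := period_shift 0 d T0; rewrite add0r => /andP[z1 z2].
have := HK (d + z%:~R * (pi *+ 2)).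
rewrite /= in_itv/= z1 ltW// /linear_coef addrA.
rewrite !(periodic_int z _ (@sinD2pi R)) !(periodic_int z _ (@cosD2pi R)).
by rewrite (periodic_int z _ gamma_circle); apply.
Qed.

(** The values of the stabilizing function at [t] for which the quadratic
    polynomial in [r] is nonnegative, whatever the new angle [t + d]. *)
Definition admissible (t : R) : set R :=
  [set K | 0 <= K /\ forall d r, 0 <= r ->
     0 <= gamma t * r ^+ 2 + K * sin d ^+ 2 * r ^+ 2
          - r * linear_coef t d + gamma t].

(** With [linear_coef t d] replaced by its upper bound [2 * gamma t + K * s],
    where [s] is the squared sine, the discriminant is nonpositive for
    [k >= K + K ^+ 2 * s / (4 * gamma t)], and [s <= 1]. *)
Lemma admissible_neq0 (t : R) : exists K, admissible t K.
Proof.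
have [K K0 HK] := linear_coef_bound t.
have g0 := gamma_gt0 t.
exists (K + K ^+ 2 / (4 * gamma t)).
have k0 : 0 <= K ^+ 2 / (4 * gamma t).
  by rewrite divr_ge0 ?sqr_ge0// mulr_ge0// ltW.
split=> [|d r r0]; first exact: addr_ge0.
set k := K + _; set s := sin d ^+ 2.
have s0 : 0 <= s by exact: sqr_ge0.
have s1 : s <= 1 by have := cos2Dsin2 d; have := sqr_ge0 (cos d); rewrite -/s; lra.
have kE : 4 * gamma t * k = 4 * gamma t * K + K ^+ 2.
  by rewrite /k; field; rewrite gt_eqF.
have H : r * linear_coef t d <= r * (2 * gamma t + K * s) by rewrite ler_wpM2l// HK.
suff : 0 <= gamma t * r ^+ 2 + k * s * r ^+ 2 - r * (2 * gamma t + K * s)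
              + gamma t by lra.
(* Completion of the square, after multiplication by [4 * gamma t]. *)
rewrite -(pmulr_rge0 _ (_ : 0 < 4 * gamma t)); last by rewrite mulr_gt0.
have -> : 4 * gamma t * (gamma t * r ^+ 2 + k * s * r ^+ 2
    - r * (2 * gamma t + K * s) + gamma t) =
  (2 * gamma t - r * (2 * gamma t + K * s)) ^+ 2
  + r ^+ 2 * (4 * gamma t * k * s - 4 * gamma t * K * s - K ^+ 2 * s ^+ 2).
  by ring.
rewrite kE addr_ge0 ?sqr_ge0// mulr_ge0 ?sqr_ge0//.
have -> : (4 * gamma t * K + K ^+ 2) * s - 4 * gamma t * K * s
  - K ^+ 2 * s ^+ 2 = K ^+ 2 * (s * (1 - s)) by ring.
by rewrite mulr_ge0 ?sqr_ge0// mulr_ge0// subr_ge0.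
Qed.

(** The set of admissible values is a periodic function of [t], so a choice that
    depends on that set alone is periodic as well. *)
Definition kmin (t : R) : R := xget 0 (admissible t).

Lemma kmin_admissible t : admissible t (kmin t).
Proof. by apply: xgetPex; exact: admissible_neq0. Qed.

Lemma kmin_circle : circle_fun kmin.
Proof.
move=> t; rewrite /kmin /admissible /linear_coef; congr (xget _ _).
apply/funext => K /=; rewrite gamma_circle (periodic_derive1 gamma_circle).
have E d : gamma (t + pi *+ 2 + d) = gamma (t + d).
  by rewrite addrAC gamma_circle.
by apply/propext; split=> -[K0 H]; split=> // d r r0; have := H d r r0; rewrite E.
Qed.

Lemma kmin_energy (k : R -> R) t d r : (forall u, kmin u <= k u) -> 0 <= r ->
  r * linear_coef t d <= gamma t * r ^+ 2 + k t * sin d ^+ 2 * r ^+ 2 + gamma t.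
Proof.
move=> hk r0; have [_ /(_ d r r0) H] := kmin_admissible t.
have : kmin t * sin d ^+ 2 * r ^+ 2 <= k t * sin d ^+ 2 * r ^+ 2.
  by rewrite !ler_wpM2r ?sqr_ge0.
lra.
Qed.

End Stabilizer.

(** * Plane vectors and the energy of one edge *)

Section Coordinates.
Variable R : realType.
Implicit Types u v w : 'cV[R]_2.

Lemma xcD u v : xc (u + v) = xc u + xc v. Proof. by rewrite /xc mxE. Qed.
Lemma ycD u v : yc (u + v) = yc u + yc v. Proof. by rewrite /yc mxE. Qed.
Lemma xcN u : xc (- u) = - xc u. Proof. by rewrite /xc mxE. Qed.
Lemma ycN u : yc (- u) = - yc u. Proof. by rewrite /yc mxE. Qed.
Lemma xcZ a u : xc (a *: u) = a * xc u. Proof. by rewrite /xc mxE. Qed.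
Lemma ycZ a u : yc (a *: u) = a * yc u. Proof. by rewrite /yc mxE. Qed.
Lemma xc_vec2 a b : xc (vec2 a b) = a :> R. Proof. by rewrite /xc mxE. Qed.
Lemma yc_vec2 a b : yc (vec2 a b) = b :> R. Proof. by rewrite /yc mxE. Qed.
Definition coordE := (xcD, ycD, xcN, ycN, xcZ, ycZ, xc_vec2, yc_vec2).

Lemma ord2_lift : lift ord0 ord0 = 1 :> 'I_2.
Proof. exact/val_inj. Qed.

Lemma xc_mat2 a b c d v : xc (mat2 a b c d *m v) = a * xc v + b * yc v :> R.
Proof. by rewrite /xc !mxE !big_ord_recl big_ord0 !mxE ord2_lift addr0. Qed.
Lemma yc_mat2 a b c d v : yc (mat2 a b c d *m v) = c * xc v + d * yc v :> R.
Proof. by rewrite /yc !mxE !big_ord_recl big_ord0 !mxE ord2_lift addr0. Qed.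

Lemma coord_inj u v : xc u = xc v -> yc u = yc v -> u = v.
Proof.
move=> hx hy; apply/matrixP => i j; rewrite !ord1.
have [->|->] : i = 0 \/ i = 1; [|exact: hx|exact: hy].
by case: i => -[|[|//]] ?; [left|right]; exact/val_inj.
Qed.

Lemma enorm_ge0 u : 0 <= enorm u. Proof. exact: sqrtr_ge0. Qed.

Lemma enorm_gt0 u : u != 0 -> 0 < enorm u.
Proof.
move=> u0; rewrite sqrtr_gt0 /dot -!expr2.
rewrite lt_def; apply/andP; split; last by rewrite addr_ge0 ?sqr_ge0.
apply: contra u0; rewrite paddr_eq0 ?sqr_ge0// !sqrf_eq0.
move=> /andP[/eqP hx /eqP hy]; apply/eqP; apply: coord_inj.
  by rewrite hx /xc mxE.
by rewrite hy /yc mxE.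
Qed.

Lemma enormZ a u : 0 <= a -> enorm (a *: u) = a * enorm u.
Proof.
move=> a0; rewrite /enorm /dot !coordE.
have -> : a * xc u * (a * xc u) + a * yc u * (a * yc u) =
  a ^+ 2 * (xc u * xc u + yc u * yc u) by ring.
by rewrite sqrtrM ?sqr_ge0// sqrtr_sqr ger0_norm.
Qed.

End Coordinates.

Section EdgeEnergy.
Variables (R : realType) (gamma k : R -> R).

(** Divided by the length of [h], this is the hypothesis on [linear_coef], with
    [d] the rotation of the edge and [r] the ratio of the lengths. *)
Lemma edge_energy (h h' : 'cV[R]_2) (t t' : R) :
    h != 0 -> h = enorm h *: vec2 (cos t) (sin t) ->
    h' = enorm h' *: vec2 (cos t') (sin t') ->
    (forall d r, 0 <= r -> r * linear_coef gamma t d <=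
       gamma t * r ^+ 2 + k t * sin d ^+ 2 * r ^+ 2 + gamma t) ->
  enorm h' * gamma t' - enorm h * gamma t <=
  enorm h * dot (Gk gamma k t *m ((enorm h)^-1 *: h')) ((enorm h)^-1 *: (h' - h)).
Proof.
move=> /enorm_gt0; move: (enorm_ge0 h').
set L := enorm h; set L' := enorm h' => L'0 L0 hE h'E.
have r0 : 0 <= L' / L by rewrite divr_ge0// ltW.
move=> /(_ (t' - t) _ r0).
rewrite /linear_coef (addrC t) subrK sinB cosB.
rewrite /dot mulmxDl -scalemxAl !(coordE, xc_mat2, yc_mat2) hE h'E !coordE.
set g := gamma t; set g' := gamma t'; set dg := _^`()%classic t.
have := cos2Dsin2 t; have := cos2Dsin2 t'.
set c := cos t; set s := sin t; set c' := cos t'; set s' := sin t'.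
move=> e' _; set r := L' / L => H.
have LrE : L' = L * r by rewrite mulrC divfK// gt_eqF.
have rE x : L^-1 * (L * r * x) = r * x by rewrite -mulrA mulKf// gt_eqF.
have rBE x y : L^-1 * (L * r * x - L * y) = r * x - y.
  by rewrite -mulrA -mulrBr mulKf// gt_eqF.
rewrite LrE !rE !rBE -mulrA -mulrBr; apply: ler_wpM2l; first exact: ltW.
(* The rotation part of the matrix yields the two terms that are linear in [r]
   and the stabilizer is the square of the component of [h'] normal to [h]. *)
set rhs := (X in _ <= X).
have -> : rhs = g * r ^+ 2 * (c' ^+ 2 + s' ^+ 2)
    - r * (g * (c' * c + s' * s) - dg * (s' * c - c' * s))
    + k t * (s' * c - c' * s) ^+ 2 * r ^+ 2 by rewrite /rhs; ring.
by rewrite e'; move: H; rewrite !mulrDr !mulrN; lra.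
Qed.

End EdgeEnergy.

(** * Mass lumping on piecewise affine functions *)

Section Elements.
Variables (R : realType) (N : nat).
Hypothesis N0 : (0 < N)%N.
Implicit Types (u g : R -> R) (X Y : R -> 'cV[R]_2) (i : nat).

Let NR0 : 0 < N%:R :> R. Proof. by rewrite ltr0n. Qed.

Lemma rho_lt i : rho R N i < rho R N i.+1.
Proof. by rewrite /rho ltr_pM2r ?invr_gt0// ltr_nat. Qed.

Lemma rho0 : rho R N 0 = 0. Proof. by rewrite /rho mul0r. Qed.
Lemma rhoN : rho R N N = 1. Proof. by rewrite /rho divff// gt_eqF. Qed.

Lemma step_in T (c : nat -> T) i (r : R) :
  rho R N i < r < rho R N i.+1 -> step N c r = c i.+1.
Proof.
rewrite /rho ltr_pdivrMr// ltr_pdivlMr// => /andP[h1 h2].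
by rewrite /step (@truncn_def _ _ i)// ltW.
Qed.

(** The affine function that agrees with [u] at the ends of the element number
    [i.+1]; being affine on the whole line, it turns one-sided limits at the nodes
    into values. *)
Definition interp u i (r : R) : R :=
  u (rho R N i) + (u (rho R N i.+1) - u (rho R N i)) * (N%:R * r - i%:R).

Lemma interp_left u i : interp u i (rho R N i) = u (rho R N i).
Proof. by rewrite /interp /rho mulrC; field; rewrite gt_eqF. Qed.

Lemma interp_right u i : interp u i (rho R N i.+1) = u (rho R N i.+1).
Proof.
rewrite /interp; have -> : N%:R * rho R N i.+1 - i%:R = 1.
  by rewrite /rho mulrCA divff ?gt_eqF// mulr1 -natr1; ring.
by rewrite mulr1; ring.
Qed.

Lemma interp_continuous u i : continuous (interp u i).
Proof.
move=> x; apply: cvgD; first exact: cvg_cst.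
apply: cvgM; first exact: cvg_cst.
apply: cvgB; last exact: cvg_cst.
by apply: cvgM; [exact: cvg_cst | exact: cvg_id].
Qed.

Lemma Kh_interp u i (r : R) : Kh N u -> (i < N)%N ->
  rho R N i <= r <= rho R N i.+1 -> u r = interp u i r.
Proof.
move=> [_ /(_ i.+1)] + iN; rewrite iN => /(_ isT)[a [b H]] ri.
have il := rho_lt i.
rewrite /interp !H ?lexx ?(ltW il)//.
have e : N%:R * rho R N i = i%:R by rewrite /rho mulrCA divff ?mulr1// gt_eqF.
have e2 : rho R N i.+1 = rho R N i + N%:R^-1.
  by rewrite /rho -natr1 mulrDl mul1r.
rewrite e2 -e; field; rewrite gt_eqF//.
Qed.

Lemma Kh_derive1 u i (r : R) : Kh N u -> (i < N)%N ->
  rho R N i < r < rho R N i.+1 ->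
  u^`()%classic r = N%:R * (u (rho R N i.+1) - u (rho R N i)).
Proof.
move=> Ku iN /andP[r1 r2]; rewrite derive1E.
have E : \forall s \near r, u s = interp u i s.
  move: (lt_nbhsr r1) (lt_nbhsl r2); apply: filterS2 => s s1 s2.
  by apply: Kh_interp => //; rewrite !ltW.
rewrite (@near_eq_derive R R R u (interp u i) r 1 E).
set D := u _ - u _.
have H := is_deriveD (is_derive_cst (u (rho R N i)) r 1)
  (is_deriveZ D (is_deriveB (is_deriveZ (N%:R : R) (is_derive_id r 1))
                            (is_derive_cst (i%:R : R) r 1))).
case: (H : is_derive r 1 (interp u i) _) => _ ->.
by rewrite add0r subr0 [_ *: 1]mulr1 [_ *: _]mulrC.
Qed.

(** The one-sided limits in the mass lumping only see the integrand inside the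
    elements, so it may be replaced there by continuous functions [G i]. *)
Lemma lumpedE X g (G : nat -> R -> R) :
    (forall i, (i < N)%N -> continuous (G i)) ->
    (forall i r, (i < N)%N -> rho R N i < r < rho R N i.+1 -> g r = G i r) ->
  lumped N X g = 2^-1 * \sum_(0 <= i < N)
    enorm (edge N X i.+1) * (G i (rho R N i) + G i (rho R N i.+1)).
Proof.
move=> cG gG; rewrite /lumped big_add1/=; congr (_ * _).
apply: eq_big_nat => i /andP[_ iN]; congr (_ * (_ + _)).
  apply: cvg_lim => //.
  apply: cvg_trans (cvg_at_right_filter (cG i iN _)).
  apply: near_eq_cvg; near=> r; apply/esym/gG => //; apply/andP; split; near: r.
    exact: nbhs_right_gt.
  exact: nbhs_right_lt (rho_lt i).
apply: cvg_lim => //.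
apply: cvg_trans (cvg_at_left_filter (cG i iN _)).
apply: near_eq_cvg; near=> r; apply/esym/gG => //; apply/andP; split; near: r.
  exact: nbhs_left_gt (rho_lt i).
exact: nbhs_left_lt.
Unshelve. all: by end_near.
Qed.

Lemma lumped_step X (c : nat -> R) :
  lumped N X (step N c) =
  \sum_(0 <= i < N) enorm (edge N X i.+1) * c i.+1.
Proof.
rewrite (@lumpedE _ _ (fun i _ => c i.+1)); first last.
- by move=> i r _; exact: step_in.
- by move=> i _ x; exact: cvg_cst.
rewrite mulr_sumr; apply: eq_bigr => i _.
by field.
Qed.

Definition edge_normal X Y i : 'cV[R]_2 :=
  - (2^-1 / enorm (edge N X i.+1)) *: perp (edge N X i.+1 + edge N Y i.+1).

Lemma nhalf_in X Y i (r : R) : Xh N X -> Xh N Y -> (i < N)%N ->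
  rho R N i < r < rho R N i.+1 -> nhalf X Y r = edge_normal X Y i.
Proof.
move=> [Xx [Xy _ _]] [Yx [Yy _ _]] iN ri.
have D Z : Kh N (xc \o Z) -> Kh N (yc \o Z) ->
    drho Z r = N%:R *: edge N Z i.+1.
  move=> Zx Zy; rewrite /drho (Kh_derive1 Zx iN ri) (Kh_derive1 Zy iN ri).
  by apply: coord_inj; rewrite /edge /= !coordE.
rewrite /nhalf (D X)// (D Y)// enormZ ?ler0n// /edge_normal invfM.
set a := (enorm _)^-1.
by apply: coord_inj; rewrite !coordE; field; rewrite gt_eqF.
Qed.

(** The integrand of the lumped product of [phi] with the normal component of
    [Y - X] coincides with this polynomial inside the element number [i.+1]. *)
Definition velocity_poly X Y phi i (r : R) : R :=
  (xc (edge_normal X Y i) * (interp (xc \o Y) i r - interp (xc \o X) i r)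
   + yc (edge_normal X Y i) * (interp (yc \o Y) i r - interp (yc \o X) i r))
  * interp phi i r.

Lemma velocity_poly_continuous X Y phi i : continuous (velocity_poly X Y phi i).
Proof.
have cI u x : interp u i r @[r --> x] --> interp u i x by exact: interp_continuous.
move=> x; apply: cvgM; last exact: cI.
apply: cvgD; (apply: cvgM; [exact: cvg_cst|]); apply: cvgB; exact: cI.
Qed.

(** The lumped product of [phi] with the normal component of [Y - X], which
    couples the two equations of the scheme. *)
Definition velocity_form X Y phi : R :=
  2^-1 * \sum_(0 <= i < N) enorm (edge N X i.+1) *
    (velocity_poly X Y phi i (rho R N i)
     + velocity_poly X Y phi i (rho R N i.+1)).

Lemma ip_velocity X Y phi a : Xh N X -> Xh N Y -> Kh N phi ->
  ip N X (fun r => dot (nhalf X Y r) (a *: (Y r - X r))) phi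
  = a * velocity_form X Y phi.
Proof.
move=> hX hY hphi.
rewrite /ip (@lumpedE _ _ (fun i r => a * velocity_poly X Y phi i r)); first last.
- move=> i r iN ri; rewrite (nhalf_in hX hY iN ri) /velocity_poly.
  move: (edge_normal X Y i) => n; rewrite /dot !coordE.
  have [[Xx [Xy _ _]] [Yx [Yy _ _]]] := (hX, hY).
  have ri' : rho R N i <= r <= rho R N i.+1.
    by case/andP: ri => /ltW -> /ltW ->.
  by rewrite -!(Kh_interp _ iN ri')//=; ring.
- move=> i iN x; apply: cvgM; first exact: cvg_cst.
  exact: velocity_poly_continuous.
rewrite /velocity_form mulrCA; congr (_ * _); rewrite mulr_sumr.
by apply: eq_bigr => i _; ring.
Qed.

Lemma ipv_velocity X Y phi : Xh N X -> Xh N Y -> Kh N phi ->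
  ipv N X (fun r => phi r *: nhalf X Y r) (fun r => Y r - X r)
  = velocity_form X Y phi.
Proof.
move=> hX hY hphi; rewrite -[RHS]mul1r -(ip_velocity 1 hX hY hphi).
rewrite /ip /ipv; congr (lumped _ _ _); apply/funext => r.
by move: (nhalf X Y r) => n; rewrite /dot !coordE; ring.
Qed.

Lemma ip_ds_ge0 X phi : 0 <= ip N X (ds N X phi) (ds N X phi).
Proof.
rewrite /ip /ds (_ : (fun r => _) = step N (fun j =>
  ((phi (rho R N j) - phi (rho R N j.-1)) / enorm (edge N X j)) ^+ 2)).
  rewrite lumped_step sumr_ge0// => i _.
  by rewrite mulr_ge0 ?sqr_ge0 ?enorm_ge0.
by apply/funext => r; rewrite /step expr2.
Qed.

Lemma ipv_stiffness gamma k X Y (theta : nat -> R) :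
  ipv N X (fun r => Gk gamma k (step N theta r) *m dsv N X Y r)
          (dsv N X (fun r => Y r - X r))
  = \sum_(0 <= i < N) enorm (edge N X i.+1) *
      dot (Gk gamma k (theta i.+1)
             *m ((enorm (edge N X i.+1))^-1 *: edge N Y i.+1))
          ((enorm (edge N X i.+1))^-1 *: (edge N Y i.+1 - edge N X i.+1)).
Proof.
rewrite /ipv (_ : (fun r => _) = step N (fun j =>
  dot (Gk gamma k (theta j) *m ((enorm (edge N X j))^-1 *: edge N Y j))
      ((enorm (edge N X j))^-1 *: (edge N Y j - edge N X j)))).
  exact: lumped_step.
apply/funext => r; rewrite /dsv /step /edge; congr (dot _ (_ *: _)).
by apply: coord_inj; rewrite !coordE; ring.
Qed.

Lemma Kh_cst (a : R) : Kh N (cst a).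
Proof.
split; first by move=> x; exact: cvg_cst.
by move=> j _; exists a, 0 => r _; rewrite mul0r addr0.
Qed.

Lemma KhB u v : Kh N u -> Kh N v -> Kh N (fun r => u r - v r).
Proof.
move=> [cu hu] [cv hv]; split.
  by move=> x; apply: cvgB; [exact: cu | exact: cv].
move=> j jN; have [a [b ab]] := hu j jN; have [c [d cd]] := hv j jN.
by exists (a - c), (b - d) => r rj; rewrite ab// cd//; ring.
Qed.

Lemma XhB X Y : Xh N X -> Xh N Y -> Xh N (fun r => X r - Y r).
Proof.
move=> [Xx [Xy X0 X1]] [Yx [Yy Y0 Y1]].
have xE : xc \o (fun r => X r - Y r) = (fun r => (xc \o X) r - (xc \o Y) r).
  by apply/funext => r /=; rewrite !coordE.
have yE : yc \o (fun r => X r - Y r) = (fun r => (yc \o X) r - (yc \o Y) r).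
  by apply/funext => r /=; rewrite !coordE.
split; first by rewrite xE; exact: KhB.
rewrite yE; split; first exact: KhB.
  by rewrite X0 Y0 subrr.
by rewrite X1 Y1 subrr.
Qed.

(** Each element contributes its change of area, up to the increment of a
    nodal quantity that vanishes where both curves are on the axis. *)
Lemma velocity_form1 X Y : Xh N X -> Xh N Y ->
    (forall j, (1 <= j <= N)%N -> edge N X j != 0) ->
  velocity_form X Y (cst 1) = area N Y - area N X.
Proof.
move=> [_ [_ X0 X1]] [_ [_ Y0 Y1]] eX.
rewrite /= -/(comp yc X) in X0 X1 Y0 Y1.
pose x j := xc (X (rho R N j)); pose y j := yc (X (rho R N j)).
pose x' j := xc (Y (rho R N j)); pose y' j := yc (Y (rho R N j)).
pose P j := x j * y j + x j * y' j - x' j * y j - x' j * y' j.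
have P0 : P 0%N = 0 by rewrite /P /y /y' rho0 X0 Y0; ring.
have PN : P N = 0 by rewrite /P /y /y' rhoN X1 Y1; ring.
rewrite /velocity_form /area !big_add1 -mulrBr; congr (_ * _).
have T : \sum_(0 <= i < N) (P i.+1 - P i) = 0.
  by rewrite telescope_sumr// PN P0 subrr.
rewrite -sumrB -[RHS]addr0 -[X in _ = _ + X]T -big_split/=.
apply: eq_big_nat => i /andP[_ iN].
have e0 : 0 < enorm (edge N X i.+1) by apply/enorm_gt0/eX.
rewrite /velocity_poly /= !interp_left !interp_right /edge_normal.
set e := enorm _ in e0 *.
rewrite /edge !coordE /= -/(x i) -/(x i.+1) -/(y i) -/(y i.+1).
rewrite -/(x' i) -/(x' i.+1) -/(y' i) -/(y' i.+1) /P.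
by field; rewrite gt_eqF.
Qed.

End Elements.

(** * One time step *)

Section OneStep.
Variables (R : realType) (gamma k : R -> R) (sigma eta tau : R) (N : nat).
Hypotheses (N0 : (0 < N)%N) (tau0 : 0 < tau) (eta0 : 0 < eta).
Variables (X Y : R -> 'cV[R]_2) (theta theta' : nat -> R) (mu : R -> R).
Hypotheses (hX : Xh N X) (edgeX : forall j, (1 <= j <= N)%N -> edge N X j != 0).
Hypothesis stepXY : spfem_step N gamma k sigma eta tau X theta Y mu.

Let hY : Xh N Y. Proof. by case: stepXY. Qed.

(** Test the first equation with the constant [1]. *)
Lemma area_step : area N Y = area N X.
Proof.
have [_ _ H _ _] := stepXY.
have := H (cst 1) (Kh_cst N 1).
rewrite (ip_velocity N0 _ hX hY (Kh_cst N 1)) (velocity_form1 N0 hX hY edgeX).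
have -> : ip N X (ds N X mu) (ds N X (cst 1)) = 0.
  rewrite /ip (_ : (fun r => _) = step N (fun=> 0)).
    by rewrite lumped_step// big1// => i _; rewrite mulr0.
  by apply/funext => r; rewrite /ds /step subrr mul0r mulr0.
rewrite addr0 => /eqP; rewrite mulf_eq0 invr_eq0 gt_eqF//= subr_eq0.
by move/eqP.
Qed.

(** Testing the first equation with [mu] and the second one with [Y - X] makes the
    coupling terms cancel; there remain the dissipation of [mu] and that of the
    contact points, while [edge_energy] bounds the stiffness term from below. *)
Lemma energy_step :
    is_angle N X theta -> is_angle N Y theta' ->
    (forall t d r, 0 <= r -> r * linear_coef gamma t d <=
       gamma t * r ^+ 2 + k t * sin d ^+ 2 * r ^+ 2 + gamma t) ->
  energy N gamma sigma Y theta' <= energy N gamma sigma X theta.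
Proof.
move=> angX angY gammaQ.
have [_ Kmu H1 H2 _] := stepXY.
have := H1 mu Kmu; rewrite (ip_velocity N0 _ hX hY Kmu) => dissipation.
have {H1} Vle0 : velocity_form N X Y mu <= 0.
  have ge0 := ip_ds_ge0 N0 X mu.
  rewrite -(pmulr_rle0 _ (_ : 0 < tau^-1)) ?invr_gt0//; lra.
have := H2 _ (XhB hY hX); rewrite (ipv_velocity N0 hX hY Kmu) ipv_stiffness//.
rewrite !(xcD, xcN).
set S := \sum_(0 <= i < N) _.
set l := xc (Y 0) - xc (X 0); set r := xc (Y 1) - xc (X 1).
have ends : 0 <= eta^-1 * (l / tau * l + r / tau * r).
  have sq a : 0 <= a / tau * a.
    by rewrite mulrAC divr_ge0 -?expr2 ?sqr_ge0// ltW.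
  by rewrite mulr_ge0 ?addr_ge0// invr_ge0 ltW.
move=> Seq.
suff Sle : \sum_(0 <= i < N) (enorm (edge N Y i.+1) * gamma (theta' i.+1)
    - enorm (edge N X i.+1) * gamma (theta i.+1)) <= S.
  rewrite sumrB in Sle; rewrite /energy !big_add1/=.
  by rewrite {}/l {}/r in ends Seq; lra.
apply: ler_sum_nat => i /andP[_ iN].
by apply: edge_energy; [exact: edgeX|exact: angX|exact: angY|exact: gammaQ].
Qed.

End OneStep.

Theorem theorem6p1 (R : realType) (gamma : R -> R)
  (gamma_circle : circle_fun gamma)
  (gamma_gt0 : forall t, 0 < gamma t)
  (gamma_C1 : circle_C1 gamma)
  (gamma_C2 : circle_piecewise_C2 gamma)
  (gamma_3 : forall t, gamma (t - pi) <= 3 * gamma t)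
  (gamma_eq : forall t, 3 * gamma t = gamma (t - pi) -> gamma^`() t = 0) :
  exists kstar : R -> R,
    [/\ circle_fun kstar, forall t, 0 <= kstar t &
    forall k : R -> R,
      circle_fun k -> (forall t, 0 <= k t) -> (forall t, kstar t <= k t) ->
    forall (sigma eta : R), 0 < eta ->
    forall (N : nat) (tau : R), (2 < N)%N -> 0 < tau ->
    forall (Xinit : R -> 'cV[R]_2), open_curve Xinit ->
    forall (X : nat -> R -> 'cV[R]_2) (mu : nat -> R -> R)
      (theta : nat -> nat -> R),
      spfem_solution N gamma k sigma eta tau Xinit X mu theta ->
    forall m : nat,
      [/\ area N (X m.+1) = area N (X m),
          area N (X m) = area N (X 0%N),
          energy N gamma sigma (X m.+1) (theta m.+1)
            <= energy N gamma sigma (X m) (theta m) &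
          energy N gamma sigma (X m) (theta m)
            <= energy N gamma sigma (X 0%N) (theta 0%N)]].
Proof.
have kminA := kmin_admissible gamma_circle gamma_gt0 gamma_C1 gamma_C2
  gamma_3 gamma_eq.
exists (kmin gamma); split; first exact: kmin_circle.
  by move=> t; have [] := kminA t.
move=> k _ _ kle sigma eta eta0 N tau N2 tau0 Xinit _ X mu theta sol.
have N0 : (0 < N)%N by apply: leq_trans N2.
have hX m : Xh N (X m).
  by case: m => [|m]; [exact: spfem_X0 sol | case: (spfem_eq sol m)].
have areaS m : area N (X m.+1) = area N (X m).
  exact: (area_step N0 tau0 (hX m) (spfem_edge sol m) (spfem_eq sol m)).
have energyS m : energy N gamma sigma (X m.+1) (theta m.+1)
    <= energy N gamma sigma (X m) (theta m).
  apply: (energy_step N0 tau0 eta0 (hX m) (spfem_edge sol m) (spfem_eq sol m)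
            (spfem_angle sol m) (spfem_angle sol m.+1)).
  by move=> t d r r0; exact: kmin_energy.
move=> m; split=> //; elim: m => // m IH; first by rewrite areaS.
exact: le_trans (energyS m) IH.
Qed.
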